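(* Let $(P,\preceq)$ be an infinite, locally finite lattice, let $x_1,\dots,x_n$ be distinct elements of $P$ such that $x_i\preceq x_j$ implies $i\le j$, and put $S_n=\{x_1,\dots,x_n\}$. Let $f:P\to\mathbb{R}$ take nonnegative values, be order-preserving on $\mathrm{meetcl}(S_n)$, and be increasing in $S_n$ with respect to the indices, i.e. $i\le j\Rightarrow f(x_i)\le f(x_j)$. Let $\lambda_1\le\lambda_2\le\cdots\le\lambda_n$ be the eigenvalues of the meet matrix $(S_n)_f$. Then $\lambda_k\le k f(x_k)$ for all $k=1,\dots,n$, and moreover $f(x_n)\le\lambda_n$.
   Context: $\mathrm{meetcl}(S_n)$ denotes the smallest subset of $P$ containing $S_n$ and closed under the meet $\wedge$. $f$ is order-preserving on a set $T$ if $x,y\in T$, $x\preceq y$ implies $f(x)\le f(y)$. The meet matrix $(S_n)_f$ is the $n\times n$ real symmetric matrix with $(i,j)$ entry $f(x_i\wedge x_j)$. *)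

(* Defs.v *)
From HB Require Import structures.
From mathcomp Require Import all_boot all_order all_algebra.
From mathcomp Require Import boolp classical_sets functions cardinality.
From mathcomp Require Import set_interval reals.

Set Implicit Arguments.
Unset Strict Implicit.
Unset Printing Implicit Defensive.

Import Order.TTheory GRing.Theory Num.Theory.

Local Open Scope classical_set_scope.
Local Open Scope ring_scope.

Definition locally_finite (d : Order.disp_t) (P : porderType d) : Prop :=
  forall a b : P, finite_set [set z : P | (a <= z <= b)%O].

Definition meet_closed (d : Order.disp_t) (P : latticeType d) (T : set P) : Prop :=
  forall a b : P, T a -> T b -> T (Order.meet a b).

Definition meetcl (d : Order.disp_t) (P : latticeType d) (S : set P) : set P :=
  smallest (@meet_closed d P) S.

Definition meet_matrix (d : Order.disp_t) (P : latticeType d) (R : realType)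
    (n : nat) (x : 'I_n -> P) (f : P -> R) : 'M[R]_n :=
  \matrix_(i, j) f (Order.meet (x i) (x j)).

(* The eigenvalues are listed with their algebraic multiplicities. *)
Definition ordered_eigenvalues (R : realType) (n : nat) (A : 'M[R]_n)
    (lambda : 'I_n -> R) : Prop :=
  {homo lambda : i j / (i <= j)%N >-> i <= j} /\
  char_poly A = \prod_(i < n) ('X - (lambda i)%:P).

(* Main.v *)
(** Over the algebraically closed field [R[i]] the meet matrix [A] is unitarily
    diagonalizable, and its eigenvalues are exactly the [lambda i].  Counting
    dimensions, some nonzero vector [v] supported on the first [k] coordinates
    is orthogonal to the first [k - 1] eigenvectors, so that
    [lambda_k |v|^2 <= v A v^*].  The leading [k x k] block of [A] has entries
    in [[0, f (x_k)]], and AM-GM gives [v A v^* <= k f (x_k) |v|^2].  The bound on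
    [lambda_n] is the Rayleigh quotient of the last basis vector. *)
Require Import Defs.
From HB Require Import structures.
From mathcomp Require Import all_boot all_order all_fingroup all_algebra.
From mathcomp Require Import ring complex.
From mathcomp Require Import boolp classical_sets functions cardinality.
From mathcomp Require Import set_interval reals.

Set Implicit Arguments.
Unset Strict Implicit.
Unset Printing Implicit Defensive.

Import Order.TTheory GRing.Theory Num.Theory.

Local Open Scope classical_set_scope.
Local Open Scope ring_scope.
Local Open Scope sesquilinear_scope.

Lemma char_poly_conj (F : fieldType) n (P D : 'M[F]_n) :
  P \in unitmx -> char_poly (invmx P *m D *m P) = char_poly D.
Proof.
move=> Pu; rewrite /char_poly.
have -> : char_poly_mx (invmx P *m D *m P) =
    map_mx polyC (invmx P) *m char_poly_mx D *m map_mx polyC P.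
  rewrite /char_poly_mx !map_mxM mulmxBr mulmxBl; congr (_ - _).
  by rewrite scalar_mxC -mulmxA -map_mxM mulVmx // map_mx1 mulmx1.
rewrite !det_mulmx mulrAC -det_mulmx -map_mxM mulVmx //.
by rewrite map_mx1 det1 mul1r.
Qed.

(** The spectral theorem lists the eigenvalues in an order of its own. Unique factorization of the
    characteristic polynomial matches that list with [l] up to a permutation, which is absorbed into
    the rows of the unitary matrix. *)
Lemma unitary_diagonalization (C : numClosedFieldType) n (A : 'M[C]_n)
    (l : 'I_n -> C) :
  A \is normalmx -> char_poly A = \prod_i ('X - (l i)%:P) ->
  exists2 Q : 'M[C]_n, Q \is unitarymx &
    A = Q^t* *m diag_mx (\row_i l i) *m Q.
Proof.
move=> /orthomx_spectralP; set P := spectralmx A; set sp := spectral_diag A.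
have Pu : P \is unitarymx by exact: spectral_unitarymx.
move=> AE chiA.
have: perm_eq [tuple l i | i < n] [tuple sp 0 i | i < n].
  apply: prod_XsubC_eq; rewrite !big_image /= -chiA AE.
  rewrite char_poly_conj ?unitarymx_unit // char_poly_trig ?diag_mx_is_trig //.
  by apply: eq_bigr => i _; rewrite mxE eqxx.
move=> /tuple_permP[s ls].
have lE i : l i = sp 0 (s i).
  have /(congr1 (fun t => tnth t i)) := val_inj ls.
  by rewrite !tnth_mktuple.
exists (row_perm s P).
  rewrite row_permE mul_unitarymx // qualifE /= tr_perm_mx map_perm_mx.
  by rewrite -perm_mxM mulgV perm_mx1.
have -> : diag_mx (\row_i l i) = perm_mx s *m diag_mx sp *m (perm_mx s)^t*.
  rewrite tr_perm_mx map_perm_mx -row_permE -col_permE.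
  by apply/matrixP => i j; rewrite !mxE lE (inj_eq perm_inj).
rewrite [LHS]AE invmx_unitary // row_permE trmx_mul map_mxM !mulmxA.
rewrite !tr_perm_mx !map_perm_mx.
have K m (X : 'M[C]_(m, n)) : X *m perm_mx s^-1 *m perm_mx s = X.
  by rewrite -mulmxA -perm_mxM mulVg perm_mx1 mulmx1.
by rewrite !K.
Qed.

Section Rayleigh.
Variables (C : numClosedFieldType) (n : nat) (A Q : 'M[C]_n) (l : 'I_n -> C).
Hypothesis Qu : Q \is unitarymx.
Hypothesis AE : A = Q^t* *m diag_mx (\row_i l i) *m Q.

Lemma rayleigh_diag (v : 'rV[C]_n) :
  (v *m A *m v^t*) 0 0 = \sum_i l i * `|(v *m Q^t*) 0 i| ^+ 2.
Proof.
have -> : v *m A *m v^t* =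
    v *m Q^t* *m diag_mx (\row_i l i) *m (v *m Q^t*)^t*.
  by rewrite trmx_mul map_mxM trmxCK AE !mulmxA.
rewrite mxE; apply: eq_bigr => i _.
by rewrite mul_mx_diag !mxE mulrAC normCK mulrC.
Qed.

Lemma unitary_sqnorm (v : 'rV[C]_n) :
  \sum_i `|(v *m Q^t*) 0 i| ^+ 2 = \sum_i `|v 0 i| ^+ 2.
Proof.
have E (w : 'rV[C]_n) : (w *m w^t*) 0 0 = \sum_i `|w 0 i| ^+ 2.
  by rewrite mxE; apply: eq_bigr => i _; rewrite !mxE normCK.
by rewrite -!E trmx_mul map_mxM trmxCK mulmxA mulmxKtV.
Qed.

Hypothesis l_homo : {homo l : i j / (i <= j)%N >-> i <= j}.

(* The constraints on [v] are [n - 1] linear equations in [n] unknowns,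
   gathered in the columns of a singular matrix. *)
Lemma exists_rayleigh_ge (k : 'I_n) : exists2 v : 'rV[C]_n, v != 0 &
  (forall i : 'I_n, (k < i)%N -> v 0 i = 0) /\
  l k * (\sum_i `|v 0 i| ^+ 2) <= (v *m A *m v^t*) 0 0.
Proof.
(* In [v *m B = 0], a column [j < k] makes [v] orthogonal to row [j] of [Q], an eigenvector, and a
   column [j > k] forces [v 0 j = 0]. The zero column [k] keeps [B] square and makes it singular. *)
pose B : 'M[C]_n := \matrix_(i, j)
  if (j < k)%N then Q^t* i j else if j == k then 0 else (i == j)%:R.
have /det0P[v v0 vB] : \det B == 0.
  rewrite -det_tr; apply/det0P; exists (delta_mx 0 k).
    apply/eqP => /rowP/(_ k); rewrite !mxE !eqxx => /eqP.
    by rewrite oner_eq0.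
  by rewrite -rowE; apply/rowP => i; rewrite !mxE ltnn eqxx.
have vBE j : \sum_i v 0 i * B i j = 0.
  by have /rowP/(_ j) := vB; rewrite !mxE.
exists v => //; split=> [i ki|].
  have := vBE i; rewrite (bigD1 i) //= big1 => [|j ji].
    rewrite mxE ltnNge (ltnW ki) /= -(inj_eq val_inj) gtn_eqF //=.
    by rewrite eqxx mulr1 addr0.
  rewrite mxE ltnNge (ltnW ki) /= -(inj_eq val_inj) gtn_eqF //=.
  by rewrite (negPf ji) mulr0.
(* In eigencoordinates the comparison is termwise: [l k <= l j] when [k <= j], and the coordinate
   vanishes when [j < k]. *)
rewrite rayleigh_diag -unitary_sqnorm mulr_sumr; apply: ler_sum => j _.
have [jk|kj] := ltnP j k; last by rewrite ler_wpM2r ?exprn_ge0 ?l_homo.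
suff -> : (v *m Q^t*) 0 j = 0 by rewrite normr0 expr0n !mulr0.
by rewrite mxE -[RHS](vBE j); apply: eq_bigr => i _; rewrite [B i j]mxE jk.
Qed.

(** A diagonal entry is the Rayleigh quotient of a unit basis vector, hence an average of the [l j]
    with nonnegative weights of sum 1. *)
Lemma diag_entry_le_max_eigenvalue (m : 'I_n) :
  (forall i, l i <= l m) -> forall i, A i i <= l m.
Proof.
move=> lm i; pose e : 'rV[C]_n := delta_mx 0 i.
have eE : (e *m A *m e^t*) 0 0 = A i i.
  rewrite -rowE mxE (bigD1 i) //= big1 => [|j /negPf ji].
    by rewrite !mxE !eqxx rmorph1 mulr1 addr0.
  by rewrite !mxE ji andbF rmorph0 mulr0.
have e1 : \sum_j `|e 0 j| ^+ 2 = 1.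
  rewrite (bigD1 i) //= big1 => [|j /negPf ji].
    by rewrite !mxE !eqxx normr1 expr1n addr0.
  by rewrite !mxE ji normr0 expr0n.
rewrite -eE rayleigh_diag -[leRHS]mulr1 -e1 -unitary_sqnorm mulr_sumr.
by apply: ler_sum => j _; rewrite ler_wpM2r ?exprn_ge0.
Qed.

End Rayleigh.

Lemma quadratic_form_le (C : numClosedFieldType) n (A : 'M[C]_n) (k : 'I_n)
    (c : C) (v : 'rV[C]_n) :
  (forall i j : 'I_n, (i <= k)%N -> (j <= k)%N -> `|A i j| <= c) ->
  (forall i : 'I_n, (k < i)%N -> v 0 i = 0) ->
  `|(v *m A *m v^t*) 0 0| <= k.+1%:R * c * \sum_i `|v 0 i| ^+ 2.
Proof.
move=> Ac v0.
have vAvE : (v *m A *m v^t*) 0 0 =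
    \sum_(j < n | (j <= k)%N) \sum_(i < n | (i <= k)%N)
      v 0 i * A i j * (v 0 j)^*.
  rewrite mxE [RHS]big_mkcond; apply: eq_bigr => j _ /=.
  case: leqP => [jk|kj]; last by rewrite !mxE v0 // rmorph0 mulr0.
  rewrite !mxE mulr_suml [RHS]big_mkcond; apply: eq_bigr => i _ /=.
  by case: leqP => // ki; rewrite v0 // !mul0r.
have c0 : 0 <= c by exact: le_trans (normr_ge0 _) (Ac k k _ _).
have sumE : \sum_i `|v 0 i| ^+ 2 = \sum_(i < n | (i <= k)%N) `|v 0 i| ^+ 2.
  rewrite [RHS]big_mkcond; apply: eq_bigr => i _ /=.
  by case: leqP => // ki; rewrite v0 // normr0 expr0n.
(* Indices start at 0, so the leading block has size [k.+1]; this is the source of the constant in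
   the bound. *)
have cardk : #|[pred i : 'I_n | (i <= k)%N]| = k.+1.
  have w_inj : injective (widen_ord (ltn_ord k)).
    by move=> i j /(congr1 val) ij; apply: val_inj.
  rewrite -[RHS]card_ord -(card_imset _ w_inj).
  apply: eq_card => i; apply/idP/imsetP => [/= ik|[j _ ->]].
    by exists (Ordinal (ik : (i < k.+1)%N)) => //; apply: val_inj.
  by rewrite inE /= -ltnS.
(* Both sides are doubled so that [2ab <= a^2 + b^2] applies to each pair [(i, j)]; in the double
   sum each [|v_i|^2] is then counted [2 * k.+1] times. *)
have two_gt0 : 0 < 2 :> C by [].
rewrite -(ler_pM2l two_gt0) vAvE.
have -> : 2 * (k.+1%:R * c * \sum_i `|v 0 i| ^+ 2) =
    \sum_(j < n | (j <= k)%N) \sum_(i < n | (i <= k)%N)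
      c * (`|v 0 i| ^+ 2 + `|v 0 j| ^+ 2).
  under [RHS]eq_bigr => j _ do rewrite -mulr_sumr big_split /= sumr_const cardk.
  rewrite -mulr_sumr big_split /= sumr_const cardk sumrMnl -sumE.
  by rewrite -[X in c * (X + _)]mulr_natl; ring.
rewrite -ler_pdivlMl // (le_trans (ler_norm_sum _ _ _)) // ler_pdivlMl //.
rewrite mulr_sumr; apply: ler_sum => j jk.
apply: le_trans (ler_wpM2l (ltW two_gt0) (ler_norm_sum _ _ _)) _.
rewrite mulr_sumr; apply: ler_sum => i ik.
rewrite !normrM norm_conjC.
set a := `|v 0 i|; set b := `|v 0 j|.
have ab : 2 * (a * b) <= a ^+ 2 + b ^+ 2.
  rewrite -subr_ge0 (_ : _ - _ = (a - b) ^+ 2); last by ring.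
  by rewrite real_exprn_even_ge0 // rpredB ?normr_real.
apply: le_trans (ler_wpM2l c0 ab).
rewrite (_ : c * (2 * (a * b)) = 2 * (a * c * b)); last by ring.
by rewrite ler_pM2l // ler_wpM2r ?normr_ge0 // ler_wpM2l ?normr_ge0 ?Ac.
Qed.

Lemma meet_matrix_entry_le (d : Order.disp_t) (P : latticeType d)
    (R : realType) n (x : 'I_n -> P) (f : P -> R) (i j : 'I_n) :
  {in meetcl (range x) &, {homo f : a b / (a <= b)%O >-> a <= b}} ->
  meet_matrix x f i j <= f (x i).
Proof.
move=> fhomo; rewrite mxE.
have inx l : meetcl (range x) (x l) by move=> T [_ xT]; apply: xT; exists l.
apply: fhomo; rewrite ?leIl // inE //.
by move=> T [Tcl xT]; apply: Tcl; apply: xT; [exists i|exists j].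
Qed.

Theorem theorem5p3 (d : Order.disp_t) (P : latticeType d) (R : realType)
  (n : nat) (x : 'I_n.+1 -> P) (f : P -> R) (lambda : 'I_n.+1 -> R)
  (P_infinite : infinite_set [set: P])
  (P_locally_finite : locally_finite P)
  (x_distinct : injective x)
  (x_linext : forall i j : 'I_n.+1, (x i <= x j)%O -> (i <= j)%N)
  (f_ge0 : forall p : P, 0 <= f p)
  (f_order_preserving :
    {in meetcl (range x) &, {homo f : a b / (a <= b)%O >-> a <= b}})
  (f_increasing : forall i j : 'I_n.+1, (i <= j)%N -> f (x i) <= f (x j))
  (lambda_eigen : ordered_eigenvalues (meet_matrix x f) lambda) :
  (forall k : 'I_n.+1, lambda k <= k.+1%:R * f (x k)) /\
  f (x ord_max) <= lambda ord_max.
Proof.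
case: lambda_eigen => lambda_homo chi.
pose rc := real_complex R; pose A := map_mx rc (meet_matrix x f).
pose l i := rc (lambda i).
have rc_real a : rc a \is Num.real by rewrite complex_real.
have l_real i : l i \is Num.real by exact: rc_real.
have l_homo : {homo l : i j / (i <= j)%N >-> i <= j}.
  by move=> i j ij; rewrite lecR lambda_homo.
have [Q Qu AE] : exists2 Q : 'M_n.+1, Q \is unitarymx &
    A = Q^t* *m diag_mx (\row_i l i) *m Q.
  (* A real symmetric matrix stays hermitian, hence normal, over [R[i]]. *)
  apply: unitary_diagonalization.
    apply: hermitian_normalmx; apply: realsym_hermsym.
      apply/is_hermitianmxP; rewrite expr0 scale1r map_mx_id //.
      by apply/matrixP => i j; rewrite !mxE meetC.
    by apply/mxOverP => i j; rewrite mxE rc_real.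
  rewrite -map_char_poly chi rmorph_prod; apply: eq_bigr => i _.
  by rewrite rmorphB /= map_polyX map_polyC.
split=> [k|]; last first.
  rewrite -lecR -[f _](_ : meet_matrix x f ord_max ord_max = _).
    have := diag_entry_le_max_eigenvalue Qu AE (m := ord_max).
    by move=> /(_ (fun i => l_homo i ord_max (leq_ord i)) ord_max); rewrite mxE.
  by rewrite mxE meetxx.
have [v v0 [vk lv]] := exists_rayleigh_ge Qu AE l_homo k.
have vpos : 0 < \sum_i `|v 0 i| ^+ 2.
  rewrite lt_neqAle sumr_ge0 ?andbT => [|i _]; last by rewrite exprn_ge0.
  apply: contraNneq v0 => /esym/eqP; rewrite psumr_eq0 => [/allP z|i _].
    apply/eqP/rowP => i; rewrite mxE; apply/eqP.
    by have := z i (mem_index_enum i); rewrite expf_eq0 /= normr_eq0.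
  by rewrite exprn_ge0.
(* The order on [R[i]] is partial: a number is bounded by its modulus only once it is known to be
   real, which here follows from its comparability with a real number. *)
have vAv_real : (v *m A *m v^t*) 0 0 \is Num.real.
  by rewrite -(ler_real lv) rpredM ?l_real // gtr0_real.
rewrite -lecR rmorphM rmorph_nat -(ler_pM2r vpos).
apply: le_trans lv (le_trans (real_ler_norm vAv_real) _).
apply: quadratic_form_le => // i j ik jk.
(* Nonnegativity of [f] removes the modulus; then [f (x i /\ x j) <= f (x i) <= f (x k)], as
   [i <= k]. *)
rewrite mxE ger0_norm ?lecR.
  apply: le_trans (meet_matrix_entry_le _ _ f_order_preserving) _.
  exact: f_increasing.
by rewrite mxE.
Qed.
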